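(* Let $d$ be a positive integer and let $R\in\mathcal P_d$ be a matrix of rank $k$. Then the following statements are equivalent. (a) $R\in\mathcal S_d$, i.e. $R$ is a Spearman's rho matrix. (b) For every rank decomposition $A\in\mathbb R^{d\times k}$ of $R$, there exists a $k$-dimensional random vector $V$ with mean vector $0$ and covariance matrix $I_k$ such that the marginal distributions of $AV$ (i.e. the distributions of its $d$ components) are all $\mathrm U[-\sqrt 3,\sqrt 3]$. (c) There exist a rank decomposition $A\in\mathbb R^{d\times k}$ of $R$ and a $k$-dimensional random vector $V$ with mean vector $0$ and covariance matrix $I_k$ such that the marginal distributions of $AV$ are all $\mathrm U[-\sqrt 3,\sqrt 3]$.
   Context: All random variables and random vectors are defined on a fixed atomless probability space. Vectors are treated as column vectors, $I_k$ is the $k\times k$ identity matrix, and $\mathrm U[a,b]$ is the uniform distribution on $[a,b]$. For random variables $X_1,X_2$ with continuous distribution functions $F_1,F_2$, Spearman's rho is $\rho^S(X_1,X_2)=\rho^P(F_1(X_1),F_2(X_2))=12\,\mathbb E[F_1(X_1)F_2(X_2)]-3$, where $\rho^P$ is the Pearson (linear) correlation coefficient. For a $d$-dimensional random vector $X=(X_1,\dots,X_d)$ with continuous marginal distributions, its Spearman's rho matrix is the $d\times d$ matrix with entries $\rho^S(X_i,X_j)$, $i,j=1,\dots,d$. A $d\times d$ matrix is called a Spearman's rho matrix if it is the Spearman's rho matrix of some $d$-dimensional random vector with continuous marginal distributions. $\mathcal S_d$ denotes the set of all $d\times d$ Spearman's rho matrices. $\mathcal P_d$ denotes the set of all $d\times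 d$ real symmetric positive semi-definite matrices whose diagonal entries are all equal to $1$. For $R\in\mathcal P_d$ of rank $k$, a rank decomposition of $R$ is a $d\times k$ real matrix $A$ of full column rank $k$ such that $R=AA^\top$. *)

(* Defs.v *)
From HB Require Import structures.
From mathcomp Require Import all_boot all_order all_algebra.
From mathcomp Require Import all_classical all_reals all_analysis.
From mathcomp Require Import measurable_realfun.

Set Implicit Arguments.
Unset Strict Implicit.
Unset Printing Implicit Defensive.

Import Order.TTheory GRing.Theory Num.Theory.
Import numFieldNormedType.Exports.

Local Open Scope classical_set_scope.
Local Open Scope ring_scope.

Definition atomless (d : measure_display) (T : measurableType d) (R : realType)
    (P : probability T R) : Prop :=
  forall A : set T, measurable A -> (0 < P A)%E ->
    exists B : set T, [/\ measurable B, B `<=` A, (0 < P B)%E & (P B < P A)%E].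

(* A map into R^n is measurable for the product (= Borel) sigma-algebra iff its
   coordinates are, so a random vector is given by its components. *)
Definition random_vector (d : measure_display) (T : measurableType d)
    (R : realType) (P : probability T R) (n : nat) : Type :=
  'I_n -> {RV P >-> R}.

Section RandomVectors.
Context (d : measure_display) (T : measurableType d) (R : realType)
  (P : probability T R).

Definition rvec_at (n : nat) (X : random_vector P n) (w : T) : 'cV[R]_n :=
  \col_i X i w.

Lemma measurable_mulmx_rvec (m n : nat) (A : 'M[R]_(m, n))
    (V : random_vector P n) (i : 'I_m) :
  measurable_fun [set: T] (fun w => (A *m rvec_at V w) i 0).
Proof.
rewrite (_ : (fun w => _) = (fun w => \sum_(j < n) A i j * V j w)).
  by apply: measurable_sum => j; exact: measurable_funM.
apply/funext => w; rewrite mxE; apply: eq_bigr => j _; by rewrite mxE.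
Qed.

Definition mulmx_rvec (m n : nat) (A : 'M[R]_(m, n)) (V : random_vector P n) :
    random_vector P m :=
  fun i => mfun_Sub (mem_set (measurable_mulmx_rvec A V i)).

Definition cdfR (X : {RV P >-> R}) (x : R) : R := fine (cdf X x).

Definition continuous_marginals (n : nat) (X : random_vector P n) : Prop :=
  forall i, continuous (cdfR (X i)).

Definition pearson_rho (X Y : T -> R) : R :=
  fine (covariance P X Y) / (Num.sqrt (fine 'V_P[X]) * Num.sqrt (fine 'V_P[Y])).

Definition spearman_rho (X Y : {RV P >-> R}) : R :=
  pearson_rho (cdfR X \o X) (cdfR Y \o Y).

Definition spearman_matrix (n : nat) (X : random_vector P n) : 'M[R]_n :=
  \matrix_(i, j) spearman_rho (X i) (X j).

Definition is_spearman_matrix (n : nat) (M : 'M[R]_n) : Prop :=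
  exists X : random_vector P n,
    continuous_marginals X /\ spearman_matrix X = M.

(* The expectations are extended-real; as +oo - +oo = -oo in [\bar R], the
   integral of a measurable function is finite only if the function is
   integrable.  Hence the two conditions below already force every component
   of V to be square-integrable. *)
Definition mean_zero (n : nat) (V : random_vector P n) : Prop :=
  forall i, ('E_P[V i] = 0)%E.

Definition identity_covariance (n : nat) (V : random_vector P n) : Prop :=
  forall i j, covariance P (V i) (V j) = ((1%:M : 'M[R]_n) i j)%:E.

Definition uniform_law (a b : R) (ab : a < b) (X : {RV P >-> R}) : Prop :=
  forall B : set R, measurable B -> distribution P X B = uniform_prob ab B.

Lemma ltNsqrt3 : - Num.sqrt 3 < Num.sqrt 3 :> R.
Proof. by rewrite gtrN// sqrtr_gt0. Qed.

Definition uniform_sqrt3_marginals (n : nat) (X : random_vector P n) : Prop :=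
  forall i, uniform_law ltNsqrt3 (X i).

End RandomVectors.

Arguments is_spearman_matrix {d T R} P {n} M.

Section Matrices.
Context (R : realType).

Definition correlation_matrix (n : nat) (M : 'M[R]_n) : Prop :=
  [/\ M^T = M,
      forall x : 'cV[R]_n, 0 <= (x^T *m M *m x) 0 0
    & forall i, M i i = 1].

Definition rank_decomposition (n k : nat) (M : 'M[R]_n) (A : 'M[R]_(n, k)) :
    Prop :=
  \rank A = k /\ M = A *m A^T.

End Matrices.

(* Main.v *)
Require Import Defs.
From HB Require Import structures.
From mathcomp Require Import all_boot all_order all_algebra.
From mathcomp Require Import all_classical all_reals all_analysis.
From mathcomp Require Import measurable_realfun.
From mathcomp Require Import ring lra.

Set Implicit Arguments.
Unset Strict Implicit.
Unset Printing Implicit Defensive.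

Import Order.TTheory GRing.Theory Num.Theory.
Import numFieldNormedType.Exports.

Local Open Scope classical_set_scope.
Local Open Scope ring_scope.

(* If X has continuous marginals F_i, then Z_i = sqrt 3 (2 F_i(X_i) - 1) is
   uniform on [-sqrt 3, sqrt 3] by the probability integral transform, and the
   covariance matrix of Z is the Spearman matrix M of X.  For M = A A^T with A
   of full column rank and B a left inverse of A, the vector V = B Z has
   identity covariance, and (A B - 1) Z has covariance
   (A B - 1) A A^T (A B - 1)^T = 0, so A V = Z almost surely.  Conversely, if
   A V has uniform marginals then F_i is affine on their support, so the
   Spearman matrix of A V is its covariance matrix A A^T.  A rank
   decomposition always exists, by a Cholesky factorisation. *)

(** * Cholesky factorisation and rank decompositions of positive semidefinite matrices *)

Section positive_semidefinite.
Variable R : rcfType.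

(** Handles a vanishing pivot in the Cholesky induction: the form is affine in the first coordinate,
    so a nonzero entry of [b] would let it become negative. *)
Lemma psd_corner0 (m : nat) (b : 'cV[R]_m) (D : 'M[R]_m) :
  (forall x : 'cV[R]_(1 + m), 0 <= (x^T *m block_mx 0 b^T b D *m x) 0 0) ->
  b = 0.
Proof.
move=> Mx; apply/matrixP => i j; rewrite ord1 mxE {j}.
have [//|bi0] := eqVneq (b i 0) 0.
(* On this vector the quadratic form takes the value -1. *)
have := Mx (col_mx (- (1 + D i i) / (b i 0 *+ 2))%:M (delta_mx i 0)).
rewrite tr_col_mx mul_row_block !mul_row_col !mulmx0 add0r tr_scalar_mx.
rewrite mulmxDl trmx_delta -!mulmxA mul_scalar_mx mul_mx_scalar linearZ /=.
rewrite -!colE -!rowE !mxE.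
have -> : - (1 + D i i) / (b i 0 *+ 2) * b i 0 +
   (- (1 + D i i) / (b i 0 *+ 2) * b i 0 + D i i) = -1.
  by field.
by rewrite oppr_ge0 ler10.
Qed.

(** Cholesky induction on the size, splitting off the first row and column. A zero pivot forces a
    zero column; otherwise the induction hypothesis is applied to the Schur complement of the
    pivot. *)
Lemma psd_sqrt (n : nat) (M : 'M[R]_n) : M^T = M ->
  (forall x : 'cV[R]_n, 0 <= (x^T *m M *m x) 0 0) ->
  exists L : 'M[R]_n, M = L *m L^T.
Proof.
elim: n M => [M|n IH]; first by exists 0; apply/matrixP; case.
rewrite -[n.+1]/(1 + n)%N => M; rewrite -[M]submxK.
set a := ulsubmx _; set c := ursubmx _; set b := dlsubmx _; set D := drsubmx _.
rewrite [a]mx11_scalar; move: (a 0 0) => {}a.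
rewrite tr_block_mx => /eq_block_mx[_ <- _ Dsym] psd.
have a0 : 0 <= a.
  have := psd (col_mx 1%:M 0).
  rewrite tr_col_mx mul_row_block mul_row_col.
  by rewrite trmx0 !mul0mx mulmx0 !addr0 trmx1 mul1mx mulmx1 mxE eqxx.
have [a00|an0] := eqVneq a 0.
  move: psd; rewrite a00 raddf0 => psd.
  have b0 := psd_corner0 psd.
  have [] := IH D Dsym.
    move=> x; have := psd (col_mx 0 x).
    rewrite b0 trmx0 tr_col_mx mul_row_block mul_row_col.
    by rewrite !mulmx0 !add0r.
  move=> L ->; exists (block_mx 0 0 0 L); rewrite b0.
  by rewrite tr_block_mx mulmx_block !trmx0 !mulmx0 !mul0mx !add0r.
(* The Schur complement is the value of the form on (- a^-1 b^T x, x). *)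
have [] := IH (D - a^-1 *: (b *m b^T)).
- by rewrite linearB /= linearZ /= trmx_mul trmxK Dsym.
- move=> x; have := psd (col_mx (- a^-1 *: (b^T *m x)) x).
  rewrite tr_col_mx mul_row_block mul_row_col.
  rewrite mul_mx_scalar [(_ *: _)^T]linearZ /= trmx_mul trmxK.
  rewrite scalerA mulrN mulfV// scaleN1r addNr mul0mx add0r.
  rewrite mulmxBr mulmxBl mulmxDl -!scalemxAl -scalemxAr scaleNr !mulmxA.
  by rewrite addrC -scalemxAl.
(* The first column of the factor contributes [a^-1 *: (b *m b^T)] to the lower right block, exactly
   what the Schur complement subtracted from [D]. *)
- move=> L DL; exists (block_mx (Num.sqrt a)%:M 0 ((Num.sqrt a)^-1 *: b) L).
  have sa : Num.sqrt a != 0 by rewrite sqrtr_eq0 -ltNge lt_def an0.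
  rewrite tr_block_mx mulmx_block !trmx0 !mulmx0 !mul0mx !addr0.
  rewrite tr_scalar_mx mul_mx_scalar linearZ /= mul_scalar_mx.
  rewrite !scalerA mulfV// !scale1r.
  rewrite scale_scalar_mx -expr2 sqr_sqrtr// mul_mx_scalar.
  rewrite scalerA mulfV// scale1r.
  rewrite -DL -scalemxAl -scalemxAr scalerA -invfM.
  by rewrite -expr2 sqr_sqrtr// addrC subrK.
Qed.

(** The factor from [psd_sqrt] is square, so [M] is first compressed to size [\rank M]. With [C] a
    basis of the column space and [Cp] a left inverse, [C *m Cp] fixes [M] on the left and, by
    symmetry, its transpose fixes [M] on the right; it remains to factor [Cp *m M *m Cp^T]. *)
Lemma psd_rank_decomposition (n : nat) (M : 'M[R]_n) : M^T = M ->
  (forall x : 'cV[R]_n, 0 <= (x^T *m M *m x) 0 0) ->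
  exists A : 'M[R]_(n, \rank M), \rank A = \rank M /\ M = A *m A^T.
Proof.
move=> symM psdM; pose C := col_base M.
have [Cp CpC] : exists Cp, Cp *m C = 1%:M.
  by exists (pinvmx C); rewrite mulVpmx// col_base_full.
have CCpM : C *m Cp *m M = M.
  transitivity (C *m Cp *m (C *m row_base M)); first by rewrite mulmx_base.
  by rewrite mulmxA -(mulmxA C) CpC mulmx1 mulmx_base.
have [] := @psd_sqrt _ (Cp *m M *m Cp^T).
- by rewrite !trmx_mul trmxK symM mulmxA.
- by move=> x; have := psdM (Cp^T *m x); rewrite trmx_mul trmxK !mulmxA.
move=> L NL; have ML : M = (C *m L) *m (C *m L)^T.
  rewrite trmx_mul !mulmxA -(mulmxA C) -NL !mulmxA CCpM.
  by rewrite -[in LHS]symM -[in LHS]CCpM !trmx_mul symM !mulmxA.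
(* The number of columns bounds the rank above; below, [M] is a product with this matrix as left
   factor. *)
exists (C *m L); split => //; apply/eqP; rewrite eqn_leq rank_leq_col/=.
by rewrite {1}ML mxrankM_maxl.
Qed.

End positive_semidefinite.

(** * Uniform laws: distribution function, support and polynomial moments *)

Lemma eq_measure_cdf (R : realType)
    (P Q : {measure set (measurableTypeR R) -> \bar R}) :
  (forall r : R, P `]-oo, r]%classic = Q `]-oo, r]%classic) ->
  P setT = Q setT -> (P setT < +oo)%E ->
  forall A, measurable A -> P A = Q A.
Proof.
move=> PQ PQT PT A mA.
(* A generating family stable under intersection; including [setT] lets the constant sequence
   [setT], of finite mass, exhaust the line. *)
pose G := [set A : set R | A = setT \/ exists r, A = `]-oo, r]%classic].
apply: (@measure_unique _ R (measurableTypeR R) G (fun=> setT)) => //=.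
- rewrite eqEsubset; split=> B.
    apply: smallest_sub; first exact: smallest_sigma_algebra.
    move=> _ [[a b] _ <-].
    have -> : `]a, b]%classic = `]-oo, b] `\` `]-oo, a] :> set R.
      by rewrite -[RHS]setCK setCD setCitvl setUC -[LHS]setCK setCitv.
    apply: (@measurableD _ (g_sigma_algebraType _));
      apply: sub_sigma_algebra; right.
      by exists b.
    by exists a.
  apply: smallest_sub; first exact: sigma_algebra_measurable.
  by move=> _ [->|[r ->]].
- move=> _ _ [->|[r ->]] [->|[s ->]]; rewrite ?setIT ?setTI;
    [by left|by right; exists s|by right; exists r|right].
  exists (Num.min r s); apply/seteqP; split=> x /=; rewrite !in_itv/= le_min.
    by move=> [-> ->].
  by move=> /andP.
- by move=> _; left.
- by rewrite bigcup_const//; exists 0%N.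
- by move=> _ [->|[r ->]].
Qed.

Section uniform.
Context (R : realType) (a b : R) (ab : a < b).

Lemma uniform_prob_cdf (x : R) : uniform_prob ab `]-oo, x] =
  ((Num.max a (Num.min x b) - a) / (b - a))%:E.
Proof.
rewrite /uniform_prob integral_uniform_pdf.
have -> : `]-oo, x]%classic `&` `[a, b]%classic =
    `[a, Num.min x b]%classic :> set R.
  apply/seteqP; split=> y /=; rewrite !in_itv/= le_min.
    by move=> [-> /andP[-> ->]].
  by move=> /and3P[-> -> ->].
rewrite (eq_integral (fun=> (b - a)^-1%:E)); last first.
  move=> y; rewrite inE/= in_itv/= le_min /uniform_pdf.
  by move=> /and3P[-> _ ->].
rewrite integral_cst//= lebesgue_measure_itv/= lte_fin -EFinD.
have [am|ma] := ltP a (Num.min x b).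
  by rewrite -EFinM mulrC.
by rewrite mule0 subrr mul0r.
Qed.

Lemma uniform_prob_cdf_itv (x : R) : a <= x <= b ->
  uniform_prob ab `]-oo, x] = ((x - a) / (b - a))%:E.
Proof. by move=> /andP[ax xb]; rewrite uniform_prob_cdf min_l// max_r. Qed.

Context (d : measure_display) (T : measurableType d) (P : probability T R).

(* [uniform_prob] is a measure on [measurableTypeR R], whose canonical structure
   differs from the one on [R] although the measurable sets coincide. *)
Let toR (X : {RV P >-> R}) : {mfun T >-> measurableTypeR R} :=
  @mfun_Sub _ _ T (measurableTypeR R) X (mem_set (@measurable_funPT _ _ _ _ X)).

(** The formula gives [0] at [a] and [1] at [b], so monotonicity fixes the cdf outside the segment,
    and the cdf determines the law. *)
Lemma uniform_law_cdf (X : {RV P >-> R}) :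
  (forall x, a <= x <= b -> cdf X x = ((x - a) / (b - a))%:E) ->
  uniform_law ab X.
Proof.
move=> XE B mB.
have aab : a <= a <= b by rewrite lexx ltW.
have bab : a <= b <= b by rewrite lexx ltW.
apply: (@eq_measure_cdf R (distribution P (toR X)) (uniform_prob ab)) mB;
  last 2 first.
- transitivity (1%E : \bar R); first exact: probability_setT.
  exact/esym/(probability_setT (uniform_prob ab)).
- by rewrite (le_lt_trans (probability_le1 _ _)) ?ltry.
move=> r; rewrite -[LHS]/(cdf X r); have [ra|ar] := ltP r a.
  transitivity (0%E : \bar R); [|symmetry];
    apply/eqP; rewrite eq_le measure_ge0 andbT.
    apply: (le_trans (cdf_nondecreasing X (ltW ra))).
    by rewrite XE// subrr mul0r.
  apply: (@le_trans _ _ (uniform_prob ab `]-oo, a]%classic)); last first.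
    by rewrite uniform_prob_cdf_itv// subrr mul0r.
  by rewrite le_measure ?inE//; apply: subset_itvl; rewrite bnd_simp ltW.
have [rb|br] := leP r b.
  by rewrite XE ?ar ?rb//; apply/esym/uniform_prob_cdf_itv; rewrite ar rb.
have ba1 : (b - a) / (b - a) = 1 by rewrite divff// subr_eq0 gt_eqF.
transitivity (1%E : \bar R); [|symmetry];
  apply/eqP; rewrite eq_le probability_le1//=.
  by rewrite -ba1 -XE// cdf_nondecreasing// ltW.
rewrite -ba1 -uniform_prob_cdf_itv// le_measure ?inE//.
by apply: subset_itvl; rewrite bnd_simp ltW.
Qed.

Lemma cdf_uniform_law (X : {RV P >-> R}) (x : R) : uniform_law ab X ->
  cdf X x = ((Num.max a (Num.min x b) - a) / (b - a))%:E.
Proof. by move=> uX; rewrite /cdf uX// uniform_prob_cdf. Qed.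

Lemma continuous_cdfR_uniform_law (X : {RV P >-> R}) : uniform_law ab X ->
  continuous (cdfR X).
Proof.
move=> uX.
have -> : cdfR X = fun x => (Num.max a (Num.min x b) - a) / (b - a).
  by apply/funext => x; rewrite /cdfR cdf_uniform_law.
move=> x; apply: cvgM; last exact: cvg_cst.
apply: cvgB; last exact: cvg_cst.
apply: (@continuous_max R R (cst a) (fun x => Num.min x b)).
  exact: cvg_cst.
by apply: (@continuous_min R R id (cst b)); [exact: cvg_id|exact: cvg_cst].
Qed.

Lemma uniform_law_ae (X : {RV P >-> R}) : uniform_law ab X ->
  {ae P, forall w, a <= X w <= b}.
Proof.
move=> uX; exists (X @^-1` (~` `[a, b])); split.
- by apply: measurable_funPTI; exact: measurableC.
- rewrite -[LHS]/(distribution P X _) uX//; last exact: measurableC.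
  by rewrite /uniform_prob integral_uniform_pdf setICl integral_set0.
- by move=> w /=; rewrite in_itv.
Qed.

Lemma ge0_integral_uniform_law (X : {RV P >-> R}) (f : R -> \bar R) :
  uniform_law ab X -> measurable_fun setT f -> (forall x, 0 <= f x)%E ->
  (\int[P]_w f (X w) =
   (b - a)^-1%:E * \int[lebesgue_measure]_(x in `[a, b]) f x)%E.
Proof.
move=> uX mf f0; rewrite -integral_uniform//.
rewrite -(ge0_integral_distribution (toR X) mf)//.
by apply: eq_measure_integral => A mA _; exact: uX.
Qed.

(** Stating the integrand as a derivative makes [q] the primitive in the fundamental theorem of
    calculus. The transfer to Lebesgue measure is for nonnegative functions, hence the split into
    positive and negative parts. *)
Lemma expectation_horner_uniform_law (X : {RV P >-> R}) (q : {poly R}) :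
  uniform_law ab X ->
  ('E_P[fun w => q^`().[X w]] = ((q.[b] - q.[a]) / (b - a))%:E)%E.
Proof.
move=> uX; rewrite unlock.
have cq : continuous (horner q^`()) by exact: continuous_horner.
have mq : measurable_fun setT (EFin \o horner q^`()).
  by apply/measurable_EFinP; exact: continuous_measurable_fun.
have iq : lebesgue_measure.-integrable `[a, b] (EFin \o horner q^`()).
  apply: continuous_compact_integrable; first exact: segment_compact.
  exact: continuous_subspaceT.
have := ge0_integral_uniform_law (f := (EFin \o horner q^`())^\+%E) uX.
move=> /(_ (measurable_funepos mq) (funepos_ge0 _)) posE.
have := ge0_integral_uniform_law (f := (EFin \o horner q^`())^\-%E) uX.
move=> /(_ (measurable_funeneg mq) (funeneg_ge0 _)) negE.
rewrite integralE.
rewrite (eq_integral (fun w => (EFin \o horner q^`())^\+ (X w))%E); last first.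
  by move=> w _; rewrite !funeposE.
rewrite [X in (_ - X)%E]
  (eq_integral (fun w => (EFin \o horner q^`())^\- (X w))%E); last first.
  by move=> w _; rewrite !funenegE.
rewrite posE negE.
(* Factoring out the constant requires a difference of integrals that is not of the form infinity
   minus infinity; continuity on a segment makes the positive part finite. *)
rewrite -muleBr//; last first.
  by rewrite fin_num_adde_defr//; exact: integrable_pos_fin_num.
rewrite -integralE (@continuous_FTC2 _ _ (horner q))//.
- by rewrite -EFinB -EFinM mulrC.
- exact: continuous_subspaceT.
- split; [by move=> x _; exact: derivable_horner|..].
  + by apply: cvg_at_right_filter; exact: continuous_horner.
  + by apply: cvg_at_left_filter; exact: continuous_horner.
- by move=> x _; rewrite derivE.
Qed.

End uniform.

(** * Square-integrable variables and invariance under almost sure equality *)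

Section square_integrable.
Context (d : measure_display) (T : measurableType d) (R : realType)
  (P : probability T R).

Lemma Lfun2_subset1 (X : T -> R) : X \in Lfun P 2%:E -> X \in Lfun P 1.
Proof. by apply: Lfun_subset12; exact: fin_num_measure. Qed.

Lemma Lfun2_sqr (X : T -> R) : measurable_fun setT X ->
  ('E_P[fun w => (X w ^+ 2)%R] < +oo)%E -> X \in Lfun P 2%:E.
Proof.
move=> mX; rewrite unlock => EX2; rewrite inE; apply/andP; split.
  by rewrite inE.
rewrite inE /= /finite_norm unlock /Lnorm poweR_lty//.
apply: le_lt_trans EX2; rewrite le_eqVlt; apply/orP; left; apply/eqP.
by apply: eq_integral => w _ /=; rewrite powR_mulrn// real_normK// num_real.
Qed.

(** Recovers the square integrability implicit in [mean_zero] and [identity_covariance]: for a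
    centred variable the variance is the second moment. *)
Lemma Lfun2_variance (X : T -> R) : measurable_fun setT X ->
  ('E_P[X] = 0)%E -> ('V_P[X] < +oo)%E -> X \in Lfun P 2%:E.
Proof.
move=> mX EX0; rewrite /variance unlock EX0 /= => VX; apply: Lfun2_sqr => //.
apply: le_lt_trans VX; rewrite le_eqVlt; apply/orP; left; apply/eqP.
by congr expectation; apply/funext => w; rewrite !fctE/= subr0.
Qed.

(** The variance is the integral of the nonnegative function [X ^+ 2], which vanishes almost
    everywhere once its integral does. *)
Lemma variance0_ae (X : T -> R) : measurable_fun setT X ->
  ('E_P[X] = 0)%E -> ('V_P[X] = 0)%E -> {ae P, forall w, X w = 0}.
Proof.
move=> mX EX0; rewrite /variance unlock EX0 unlock /= => VX.
have /(ae_eq_integral_abs P measurableT) : measurable_fun setT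
    (fun w => (((X - cst 0) * (X - cst 0)) w)%:E).
  apply/measurable_EFinP; apply: measurable_funM; apply: measurable_funB => //.
case=> + _; case.
  rewrite -[RHS]VX; apply: eq_integral => w _.
  by rewrite gee0_abs// lee_fin !fctE -expr2 sqr_ge0.
move=> N [mN PN subN]; exists N; split => //; apply: subset_trans subN => w /=.
apply: contra_not => /(_ I)[].
by rewrite !fctE subr0 => /eqP; rewrite mulf_eq0 orbb => /eqP.
Qed.

Lemma ae_covariance (X X' Y Y' : {RV P >-> R}) :
  {ae P, forall w, X w = X' w} -> {ae P, forall w, Y w = Y' w} ->
  covariance P X Y = covariance P X' Y'.
Proof.
move=> XX' YY'.
have aeE (U V : {RV P >-> R}) :
    {ae P, forall w, U w = V w} -> 'E_P[U]%E = 'E_P[V]%E.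
  move=> UV; rewrite unlock; apply: ae_eq_integral => //.
  - exact/measurable_EFinP.
  - exact/measurable_EFinP.
  - by apply: filterS UV => w + _ => ->.
rewrite unlock (aeE _ _ XX') (aeE _ _ YY') unlock; apply: ae_eq_integral => //.
- by apply/measurable_EFinP; apply: measurable_funM; exact: measurable_funB.
- by apply/measurable_EFinP; apply: measurable_funM; exact: measurable_funB.
- by apply: filterS2 XX' YY' => w Xw Yw _; rewrite !fctE/= Xw Yw.
Qed.

Lemma ae_uniform_law (a b : R) (ab : a < b) (X Y : {RV P >-> R}) :
  {ae P, forall w, X w = Y w} -> uniform_law ab X -> uniform_law ab Y.
Proof.
move=> XY uX B mB; rewrite -uX//.
have mXB := measurable_funPTI X mB; have mYB := measurable_funPTI Y mB.
(* Probabilities become integrals of indicators, which agree almost everywhere. *)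
rewrite /distribution /pushforward -!expectation_indic// unlock.
apply: ae_eq_integral => //.
- exact/measurable_EFinP.
- exact/measurable_EFinP.
- apply: filterS XY => w Xw _; rewrite !indicE; congr (nat_of_bool _)%:R%:E.
  by apply/idP/idP; rewrite !inE /= Xw.
Qed.

End square_integrable.

(** * Means and covariances of linear images of random vectors *)

Section linear_images.
Context (d : measure_display) (T : measurableType d) (R : realType)
  (P : probability T R).

(** A form as a sum of functions, to which linearity of expectation and covariance applies. *)
Lemma mulmx_rvecE (m n : nat) (A : 'M[R]_(m, n)) (V : random_vector P n)
  (i : 'I_m) : mulmx_rvec A V i = \sum_j (A i j \o* V j) :> (T -> R).
Proof.
apply/funext => w; rewrite fct_sumE /= !mxE; apply: eq_bigr => j _.
by rewrite mxE mulrC.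
Qed.

Lemma mulmx_rvecA (m n p : nat) (A : 'M[R]_(m, n)) (B : 'M[R]_(n, p))
    (V : random_vector P p) (i : 'I_m) :
  mulmx_rvec A (mulmx_rvec B V) i =1 mulmx_rvec (A *m B) V i.
Proof.
move=> w /=; rewrite -mulmxA; congr ((A *m _) i 0).
by apply/matrixP => j l; rewrite ord1 mxE.
Qed.

Lemma Lfun_mulmx_rvec (m n : nat) (A : 'M[R]_(m, n)) (V : random_vector P n) i :
  (forall j, (V j : T -> R) \in Lfun P 2%:E) ->
  (mulmx_rvec A V i : T -> R) \in Lfun P 2%:E.
Proof.
move=> V2; rewrite mulmx_rvecE; apply: rpred_sum; first exact: lee1n.
move=> lt12 j _.
by apply: Lfun_scale => //; rewrite ler1n.
Qed.

Lemma mean_zero_mulmx_rvec (m n : nat) (A : 'M[R]_(m, n))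
    (V : random_vector P n) :
  (forall j, (V j : T -> R) \in Lfun P 2%:E) -> mean_zero V ->
  mean_zero (mulmx_rvec A V).
Proof.
move=> V2 V0 i; rewrite mulmx_rvecE.
(* Integrability is carried through the induction because additivity of the expectation asks for it
   at each step. *)
suff [] : ((\sum_j (A i j \o* V j))%R : T -> R) \in Lfun P 1 /\
   'E_P[(\sum_j (A i j \o* V j))%R]%E = 0%E by [].
apply: (big_ind (fun Z : T -> R => Z \in Lfun P 1 /\ 'E_P[Z]%E = 0%E)).
- by split; [exact: rpred0|rewrite -[X in 'E_P[X]%E]/(cst 0) expectation_cst].
- move=> X Y [X1 X0] [Y1 Y0]; split; first exact: rpredD.
  by rewrite expectationD// X0 Y0 adde0.
- move=> j _; split; first by apply: Lfun_scale => //; exact: Lfun2_subset1.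
  by rewrite expectationZl ?V0 ?mule0//; exact: Lfun2_subset1.
Qed.

Lemma covariance_mulmx_rvecl (m n : nat) (A : 'M[R]_(m, n))
    (V : random_vector P n) (Y : T -> R) (c : 'cV[R]_n) i :
  (forall j, (V j : T -> R) \in Lfun P 2%:E) -> Y \in Lfun P 2%:E ->
  (forall j, covariance P (V j) Y = (c j 0)%:E) ->
  covariance P (mulmx_rvec A V i) Y = ((A *m c) i 0)%:E.
Proof.
move=> V2 Y2 cE; rewrite mulmx_rvecE mxE.
suff [] : ((\sum_j (A i j \o* V j))%R : T -> R) \in Lfun P 2%:E /\
   covariance P (\sum_j (A i j \o* V j)) Y = (\sum_j A i j * c j 0)%:E by [].
apply: (big_rec2 (fun (Z : T -> R) s =>
  Z \in Lfun P 2%:E /\ covariance P Z Y = s%:E)).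
- split; first by rewrite rpred0 ?lee1n.
  by rewrite -[X in covariance P X]/(cst 0) covariance_cst_l.
- move=> j s Z _ [Z2 ZE].
  have AV2 : (A i j \o* V j) \in Lfun P 2%:E.
    by apply: Lfun_scale; rewrite ?ler1n.
  split; first by rewrite rpredD ?lee1n.
  rewrite covarianceDl// ZE covarianceZl ?cE//; try exact: Lfun2_subset1.
  exact: Lfun2_mul_Lfun1.
Qed.

(** Bilinearity: the one-sided formula is used once in the left argument and, after exchanging the
    arguments, once in the right one. *)
Lemma covariance_mulmx_rvec (m n : nat) (A : 'M[R]_(m, n)) (C : 'M[R]_n)
    (V : random_vector P n) i j :
  (forall l, (V l : T -> R) \in Lfun P 2%:E) ->
  (forall l l', covariance P (V l) (V l') = (C l l')%:E) ->
  covariance P (mulmx_rvec A V i) (mulmx_rvec A V j) =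
  ((A *m C *m A^T) i j)%:E.
Proof.
move=> V2 CE; have AV2 := Lfun_mulmx_rvec A j V2.
rewrite (covariance_mulmx_rvecl A (c := col j (C *m A^T)))//.
  congr _%:E; rewrite -mulmxA [LHS]mxE [RHS]mxE.
  by apply: eq_bigr => l _; rewrite [col _ _ _ _]mxE.
move=> l; rewrite covarianceC (covariance_mulmx_rvecl A (c := (row l C)^T))//.
  congr _%:E; rewrite !mxE; apply: eq_bigr => l' _.
  by rewrite !mxE mulrC.
by move=> l'; rewrite covarianceC CE !mxE.
Qed.

End linear_images.

(** * Probability integral transform and standardised ranks *)

Section rank_transform.
Context (d : measure_display) (T : measurableType d) (R : realType)
  (P : probability T R).

Lemma cdfRE (X : {RV P >-> R}) x : (cdfR X x)%:E = cdf X x.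
Proof. by rewrite /cdfR fineK// fin_num_measure. Qed.

Lemma cdfR_le1 (X : {RV P >-> R}) x : cdfR X x <= 1.
Proof. by rewrite -lee_fin cdfRE cdf_le1. Qed.

Lemma cdfR_ge0 (X : {RV P >-> R}) x : 0 <= cdfR X x.
Proof. by rewrite -lee_fin cdfRE cdf_ge0. Qed.

Lemma cdfR_nondecreasing (X : {RV P >-> R}) : {homo cdfR X : x y / x <= y}.
Proof. by move=> x y xy; rewrite -lee_fin !cdfRE cdf_nondecreasing. Qed.

Lemma measurable_cdfR (X : {RV P >-> R}) : measurable_fun setT (cdfR X).
Proof.
apply/measurable_EFinP.
rewrite (_ : EFin \o cdfR X = cdf X); first exact: cdf_measurable.
by apply/funext => x; exact: cdfRE.
Qed.

(** Intermediate value theorem between the limits [0] and [1] at infinity. The bounds on [u] are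
    strict because the limits may not be attained. *)
Lemma cdfR_surj (X : {RV P >-> R}) (u : R) : continuous (cdfR X) ->
  0 < u < 1 -> exists x, cdfR X x = u.
Proof.
move=> cX /andP[u0 u1].
have /cvgrPdist_lt/(_ _ u0) [a [_ aP]] : cdfR X @ -oo --> (0 : R).
  exact/fine_cvg/cvg_cdfNy0.
have v0 : 0 < 1 - u by rewrite subr_gt0.
have /cvgrPdist_lt/(_ _ v0) [b [_ bP]] : cdfR X @ +oo --> (1 : R).
  exact/fine_cvg/cvg_cdfy1.
have Fa : cdfR X (a - 1) < u.
  have /aP : a - 1 < a by rewrite gtrBl.
  by rewrite sub0r normrN ger0_norm// cdfR_ge0.
have Fb : u < cdfR X (b + 1).
  have /bP : b < b + 1 by rewrite ltrDl.
  by rewrite ger0_norm ?subr_ge0 ?cdfR_le1// ltrD2l ltrN2.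
have ab : a - 1 <= b + 1.
  rewrite leNgt; apply/negP => /ltW /(cdfR_nondecreasing X).
  by rewrite leNgt (lt_trans Fa Fb).
have [|x _ <-] := @IVT _ (cdfR X) _ _ u ab (continuous_subspaceT cX).
  by rewrite ge_min (ltW Fa) le_max (ltW Fb) orbT.
by exists x.
Qed.

(** Write [F] for the cdf. If [F x = u], then [X <= x] implies [F X <= u], which gives the lower
    bound. As [F] may have flat pieces, the upper bound takes [F x = v] with [v] slightly above [u]:
    then [F X <= u] forces [X <= x]. *)
Lemma cdfR_transform (X : {RV P >-> R}) (u : R) : continuous (cdfR X) ->
  0 <= u <= 1 -> P [set w | cdfR X (X w) <= u] = u%:E.
Proof.
move=> cX /andP[u0 u1].
have mU : measurable_fun setT (cdfR X \o X).
  by apply: measurableT_comp => //; exact: measurable_cdfR.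
have mle v : measurable [set w | cdfR X (X w) <= v].
  rewrite (_ : [set _ | _] = setT `&` (cdfR X \o X) @^-1` `]-oo, v]).
    exact: mU.
  by rewrite setTI; apply/seteqP; split=> w /=; rewrite in_itv.
apply/eqP; rewrite eq_le; apply/andP; split; last first.
  have [->|un0] := eqVneq u 0; first exact: measure_ge0.
  have [->|un1] := eqVneq u 1.
    rewrite -(probability_setT P) le_measure ?inE//.
    by move=> w _ /=; exact: cdfR_le1.
  have [|x Fx] := cdfR_surj (u := u) cX.
    by rewrite !lt_def un0 u0 eq_sym un1.
  rewrite -{1}Fx cdfRE /cdf /distribution /pushforward le_measure ?inE//.
    exact: measurable_funPTI.
  by move=> w /=; rewrite in_itv/= -Fx; exact: cdfR_nondecreasing.
have [->|un1] := eqVneq u 1; first exact: probability_le1.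
have {u1}u1 : u < 1 by rewrite lt_def eq_sym un1.
apply/lee_addgt0Pr => e e0.
(* The midpoint of [u] and [1] caps [v] below [1], so that [cdfR_surj] provides a preimage. *)
have [v [uv vue v1]] : exists v, [/\ u < v, v <= u + e & v < 1].
  exists (Num.min (u + e) ((u + 1) / 2)); split.
  - by rewrite lt_min ltrDl e0/=; lra.
  - by rewrite ge_min lexx.
  - by rewrite gt_min; apply/orP; right; lra.
have [|x Fx] := cdfR_surj (u := v) cX.
  by rewrite v1 andbT (le_lt_trans u0).
apply: (@le_trans _ _ v%:E); last by rewrite -EFinD lee_fin.
rewrite -Fx cdfRE /cdf /distribution /pushforward le_measure ?inE//.
  exact: measurable_funPTI.
move=> w /= Fu; rewrite in_itv/= leNgt; apply/negP.
by move=> /ltW /(cdfR_nondecreasing X); rewrite Fx leNgt (le_lt_trans Fu).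
Qed.

Lemma measurable_std_rank (X : {RV P >-> R}) : measurable_fun setT
  (fun w => Num.sqrt 3 * (2 * cdfR X (X w) - 1)).
Proof.
apply: measurable_funM => //; apply: measurable_funB => //.
apply: measurable_funM => //; apply: measurableT_comp => //.
exact: measurable_cdfR.
Qed.

(** For a continuous cdf this scaling gives mean [0] and variance [1], so covariances of these
    variables are correlations. *)
Definition std_rank (X : {RV P >-> R}) : {RV P >-> R} :=
  mfun_Sub (mem_set (measurable_std_rank X)).

Lemma sqrt3_gt0 : 0 < Num.sqrt 3 :> R.
Proof. by rewrite sqrtr_gt0. Qed.

Lemma uniform_std_rank (X : {RV P >-> R}) : continuous (cdfR X) ->
  uniform_law (ltNsqrt3 R) (std_rank X).
Proof.
move=> cX; apply: uniform_law_cdf => x /andP[x1 x2]; have s0 := sqrt3_gt0.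
(* The right-hand side is the level that the cdf value must not exceed for the standardised rank to
   be at most [x]. *)
have -> : (x - - Num.sqrt 3) / (Num.sqrt 3 - - Num.sqrt 3) =
  (x / Num.sqrt 3 + 1) / 2.
  have s20 : Num.sqrt 3 - - Num.sqrt 3 != 0 :> R.
    by rewrite opprK gt_eqF// addr_gt0.
  by field; rewrite s20 gt_eqF.
apply: etrans (cdfR_transform cX _); last first.
  apply/andP; split.
    by rewrite divr_ge0// -lerBlDr sub0r ler_pdivlMr// mulN1r.
  by rewrite ler_pdivrMr// mul1r -lerBrDr ler_pdivrMr//; lra.
have key y : (Num.sqrt 3 * y <= x) = (y <= x / Num.sqrt 3).
  by rewrite ler_pdivlMr// mulrC.
congr (P _); apply/seteqP; split => w /=; rewrite in_itv/= key;
  by move: (x / _) (cdfR _ _) => y z; lra.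
Qed.

(** On the support the cdf is affine and [std_rank] inverts it. Off the support the cdf is constant,
    so the equality is only almost sure. *)
Lemma std_rank_uniform (X : {RV P >-> R}) : uniform_law (ltNsqrt3 R) X ->
  {ae P, forall w, std_rank X w = X w}.
Proof.
move=> uX; apply: filterS (uniform_law_ae uX) => w /andP[x1 x2] /=.
rewrite /cdfR (cdf_uniform_law _ uX) /= min_l// max_r//.
by field; rewrite gt_eqF// sqrt3_gt0.
Qed.

Section uniform_moments.
Variable X : {RV P >-> R}.
Hypothesis uX : uniform_law (ltNsqrt3 R) X.

Lemma expectation_uniform_sqrt3 : 'E_P[X]%E = 0%E.
Proof.
(* A primitive of the identity; being even, it takes equal values at the two endpoints. *)
have := expectation_horner_uniform_law (2^-1 *: 'X^2) uX.
rewrite derivZ derivXn !hornerZ !hornerXn sqrrN subrr mul0r; apply: etrans.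
by congr expectation; apply/funext => w; rewrite !hornerE; field.
Qed.

Lemma expectation_sqr_uniform_sqrt3 : 'E_P[fun w => (X w ^+ 2)%R]%E = 1%E.
Proof.
have := expectation_horner_uniform_law (3^-1 *: 'X^3) uX.
rewrite derivZ derivXn !hornerZ !hornerXn.
have -> : (3^-1 * Num.sqrt 3 ^+ 3 - 3^-1 * (- Num.sqrt 3) ^+ 3) /
   (Num.sqrt 3 - - Num.sqrt 3) = Num.sqrt 3 ^+ 2 / 3 :> R.
  have s0 := sqrt3_gt0.
  by field; rewrite opprK gt_eqF// addr_gt0.
rewrite sqr_sqrtr// divff//; apply: etrans.
congr expectation; apply/funext => w.
by rewrite hornerZ hornerMn hornerXn /=; field.
Qed.

Lemma Lfun2_uniform_sqrt3 : (X : T -> R) \in Lfun P 2%:E.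
Proof.
by apply: Lfun2_sqr => //; rewrite expectation_sqr_uniform_sqrt3 ltry.
Qed.

Lemma variance_uniform_sqrt3 : variance P X = 1%E.
Proof.
rewrite varianceE ?Lfun2_uniform_sqrt3// expectation_uniform_sqrt3.
rewrite expe2 mule0 sube0.
exact: expectation_sqr_uniform_sqrt3.
Qed.

End uniform_moments.

(** Correlation is invariant under increasing affine maps, and the standardised ranks have unit
    variance. *)
Lemma spearman_rho_std_rank (X Y : {RV P >-> R}) :
  continuous (cdfR X) -> continuous (cdfR Y) ->
  (spearman_rho X Y)%:E = covariance P (std_rank X) (std_rank Y).
Proof.
move=> cX cY.
(* The standard deviation of the uniform law on [[0, 1]]; its square cancels between the covariance
   and the normalisation. *)
pose c : R := (2 * Num.sqrt 3)^-1.
have s0 := sqrt3_gt0; have c0 : 0 < c by rewrite invr_gt0 mulr_gt0.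
have UE (Z : {RV P >-> R}) : cdfR Z \o Z = (c \o* std_rank Z) \+ cst 2^-1.
  by apply/funext => w /=; rewrite /c; field; rewrite gt_eqF.
have X2 := Lfun2_uniform_sqrt3 (uniform_std_rank cX).
have Y2 := Lfun2_uniform_sqrt3 (uniform_std_rank cY).
have cX2 : (c \o* std_rank X) \in Lfun P 2%:E.
  by apply: Lfun_scale; rewrite ?ler1n.
have cY2 : (c \o* std_rank Y) \in Lfun P 2%:E.
  by apply: Lfun_scale; rewrite ?ler1n.
have X1 := Lfun2_subset1 X2; have Y1 := Lfun2_subset1 Y2.
have cY1 := Lfun2_subset1 cY2.
have XYfin : covariance P (std_rank X) (std_rank Y) \is a fin_num.
  by rewrite covariance_fin_num// Lfun2_mul_Lfun1.
rewrite /spearman_rho /pearson_rho !UE !varianceD_cst_r// !varianceZ//.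
rewrite !variance_uniform_sqrt3; try exact: uniform_std_rank.
rewrite covarianceDl ?Lfun_cst//; last by rewrite rpredD ?lee1n//= Lfun_cst.
rewrite covariance_cst_l adde0 covarianceDr ?Lfun_cst// covariance_cst_r adde0.
rewrite (covarianceZl c X1 cY1 (Lfun2_mul_Lfun1 X2 cY2)).
rewrite (covarianceZr c X1 Y1 (Lfun2_mul_Lfun1 X2 Y2)).
rewrite mule1 /= -expr2 sqr_sqrtr ?sqr_ge0// -(fineK XYfin) -!EFinM /=.
by congr _%:E; field; rewrite gt_eqF.
Qed.

End rank_transform.

Theorem theorem2p2 (disp : measure_display) (T : measurableType disp)
    (R : realType) (P : probability T R) (hP : atomless P)
    (d k : nat) (hd : (0 < d)%N)
    (M : 'M[R]_d) (hM : correlation_matrix M) (hk : \rank M = k) :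
  [<-> is_spearman_matrix P M;
       forall A : 'M[R]_(d, k), rank_decomposition M A ->
         exists V : random_vector P k,
           [/\ mean_zero V, identity_covariance V
             & uniform_sqrt3_marginals (mulmx_rvec A V)];
       exists A : 'M[R]_(d, k), rank_decomposition M A /\
         exists V : random_vector P k,
           [/\ mean_zero V, identity_covariance V
             & uniform_sqrt3_marginals (mulmx_rvec A V)]].
Proof.
tfae.
- move=> [X [cX XM]] A [rA MA].
  pose Z : random_vector P d := fun i => std_rank (X i).
  have uZ i : uniform_law (ltNsqrt3 R) (Z i) by exact: uniform_std_rank.
  have Z2 i := Lfun2_uniform_sqrt3 (uZ i).
  have Z0 : mean_zero Z by move=> i; exact: expectation_uniform_sqrt3.
  have ZM i j : covariance P (Z i) (Z j) = (M i j)%:E.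
    by rewrite -XM mxE spearman_rho_std_rank.
  have [B BA] : exists B, B *m A = 1%:M.
    by exists (pinvmx A); rewrite mulVpmx// -col_leq_rank rA.
  exists (mulmx_rvec B Z); split.
  + exact: mean_zero_mulmx_rvec.
  + move=> i j; rewrite (covariance_mulmx_rvec B i j Z2 ZM) MA.
    by rewrite !mulmxA BA mul1mx -trmx_mul BA trmx1.
  + move=> i; apply: ae_uniform_law (uZ i).
    pose D := A *m B - 1%:M.
    have DM : D *m M = 0.
      by rewrite MA mulmxA mulmxBl -(mulmxA A) BA mulmx1 mul1mx subrr mul0mx.
    have D0 : {ae P, forall w, mulmx_rvec D Z i w = 0}.
      apply: variance0_ae => //; first exact: mean_zero_mulmx_rvec.
      rewrite /variance (covariance_mulmx_rvec D i i Z2 ZM) DM mul0mx.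
      by rewrite mxE.
    apply: filterS D0 => w Dw; rewrite mulmx_rvecA; apply/esym/eqP.
    rewrite -subr_eq0; apply/eqP; rewrite -[RHS]Dw /= mulmxBl mul1mx.
    by rewrite [RHS]mxE; congr (_ + _); rewrite !mxE.
- move=> H.
  (* The universal statement yields a witness only once some rank decomposition is known to
     exist. *)
  case: hM => symM psdM _; case: (psd_rank_decomposition symM psdM) => A.
  move: H; rewrite -hk => H [rA MA].
  by exists A; split; [|apply: H].
- move=> [A [[rA MA] [V [V0 V1 uV]]]].
  have V2 i : (V i : T -> R) \in Lfun P 2%:E.
    by apply: Lfun2_variance => //; rewrite [variance _ _]V1 ltry.
  exists (mulmx_rvec A V); have cV : continuous_marginals (mulmx_rvec A V).
    by move=> i; exact: continuous_cdfR_uniform_law (uV i).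
  split=> //; apply/matrixP => i j; rewrite mxE; apply: EFin_inj.
  rewrite spearman_rho_std_rank//.
  (* The standardised ranks of [A V] are almost surely its own components, so their covariance is
     read off from [A] and the identity covariance of [V]. *)
  rewrite (ae_covariance (std_rank_uniform (uV i)) (std_rank_uniform (uV j))).
  by rewrite (covariance_mulmx_rvec A i j V2 V1) mulmx1 MA.
Qed.
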